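(* If $\mathcal{O}(\overline{0})$ is bounded, then the set $\mathrm{PrOccupySet}_P(\alpha;\tau)=\{\overline{y}\in\mathbb{R}^n:\phi_{\boldsymbol{x}}(\overline{y};\tau)\ge\alpha\}$ is bounded for every $\alpha>0$ and every $\tau\in\{1,\dots,N\}$.
   Context: DPV system (discrete-time affine parameter-varying stochastic system). Fix $N,n,m,p,l\ge 1$, a finite set $\mathcal{P}\subset\mathbb{R}^l$ and maps $A:\mathcal{P}\to\mathbb{R}^{n\times n}$, $B:\mathcal{P}\to\mathbb{R}^{n\times m}$, $F:\mathcal{P}\to\mathbb{R}^{n\times p}$. For $t=0,\dots,N-1$, $$\boldsymbol{x}_{t+1}=A(\overline\lambda_t)\boldsymbol{x}_t+B(\overline\lambda_t)\overline{u}_t+F(\overline\lambda_t)\boldsymbol{w}_t,$$ where $\boldsymbol{x}_0=\overline{x}_0\in\mathbb{R}^n$, the parameters $\overline\lambda_t\in\mathcal{P}$ and the inputs $\overline{u}_t\in\mathbb{R}^m$ are known and deterministic, and $\boldsymbol{w}_0,\dots,\boldsymbol{w}_{N-1}$ are IID random vectors in $\mathbb{R}^p$ with a density. Obstacle: let $h_{\mathrm{obs}}:\mathbb{R}^n\to\mathbb{R}$ be Borel and $\mathcal{O}(\overline{c})=\{\overline{z}\in\mathbb{R}^n:h_{\mathrm{obs}}(\overline{z}-\overline{c})\ge0\}$ for $\overline{c}\in\mathbb{R}^n$; the shape $\mathcal{O}(\overline{0})$ is a Borel set of non-zero Lebesgue measure. The probabilistic occupancy function is $$\phi_{\boldsymbol{x}}(\overline{y};\tau)=\mathbb{P}\{\boldsymbol{x}_\tau\in\{\overline{z}\in\mathbb{R}^n:\overline{y}\in\mathcal{O}(\overline{z})\}\}.$$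 *)

(* Defs.v *)
From HB Require Import structures.
From mathcomp Require Import all_boot all_order all_algebra finmap.
From mathcomp Require Import all_classical all_reals all_analysis.
From mathcomp Require Import measurable_realfun.

Set Implicit Arguments.
Unset Strict Implicit.
Unset Printing Implicit Defensive.

Import Order.TTheory GRing.Theory Num.Theory numFieldNormedType.Exports.

Local Open Scope classical_set_scope.
Local Open Scope ring_scope.

(* Vectors of R^n are column vectors 'cV[R]_n; matrices over R carry the Borel
   sigma-algebra of their canonical topology. *)
Definition matrix_borel_display : measure_display.
Proof. exact: default_measure_display. Qed.

Section borel_matrix.
Context (R : realType) (m n : nat).
Let openM := @open 'M[R]_(m, n).

HB.instance Definition _ := @isMeasurable.Build matrix_borel_display
  'M[R]_(m, n) <<s openM >>
  (@sigma_algebra0 _ setT openM) (@sigma_algebraC _ openM)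
  (@sigma_algebra_bigcup _ setT openM).

End borel_matrix.

Section measurable_coordinates.
Context (R : realType).

Lemma measurable_coord m n (i : 'I_m) (j : 'I_n) :
  measurable_fun setT (fun M : 'M[R]_(m, n) => M i j).
Proof.
apply: measurability; first exact: (RGenOpens.measurableE R).
move=> _ [_ [a [b ->]] <-]; rewrite setTI.
apply: sub_sigma_algebra; apply: open_comp; last exact: interval_open.
by move=> M _; exact: coord_continuous.
Qed.

(* A function into R^n is Borel as soon as its coordinates are: an open set is
   a countable union of rational cubes. *)
Lemma measurable_fun_cV d (T : measurableType d) n (f : T -> 'cV[R]_n) :
  (forall i, measurable_fun setT (fun t => f t i ord0)) ->
  measurable_fun setT f.
Proof.
move=> mf; apply: measurability; first by [].
move=> _ [U oU <-]; rewrite setTI.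
pose cube (c : {ffun 'I_n -> rat} * nat) : set 'cV[R]_n :=
  [set v | forall i, ball (ratr (c.1 i) : R) (c.2.+1%:R^-1) (v i ord0)].
pose good c := `[< cube c `<=` U >].
rewrite (_ : f @^-1` U = \bigcup_c (if good c then f @^-1` cube c else set0)).
  apply: countable_bigcupT_measurable; first exact: countableP.
  move=> c; case: ifP => _; last exact: measurable0.
  rewrite (_ : _ @^-1` _ = \bigcap_(i in [set: 'I_n])
      ((fun t => f t i ord0) @^-1` ball (ratr (c.1 i) : R) (c.2.+1%:R^-1))).
    apply: fin_bigcap_measurable; first exact: finite_finset.
    move=> i _; rewrite -[X in measurable X]setTI; apply: mf => //.
    by apply: open_measurable; exact: ball_open.
  by apply/seteqP; split=> t /= h i; [move=> _|]; exact: h.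
apply/seteqP; split=> [t Uft|t [c _]]; last first.
  by case: ifP => // /asboolP cU /cU.
have /nbhs_ballP[e /= e0 eU] : nbhs (f t) U by exact: open_nbhs_nbhs.
have [k _ ke] : \forall k \near \oo, k.+1%:R^-1 < e / 2 :> R.
  exact: near_infty_natSinv_lt (PosNum (divr_gt0 e0 (ltr0Sn R 1))).
have {}ke := ke k (leqnn k).
have k0 : 0 < k.+1%:R^-1 :> R by rewrite invr_gt0.
have /(_ _)/cid-/all_sig[q qP] i : exists q : rat,
    ball (ratr q : R) k.+1%:R^-1 (f t i ord0).
  have [|q] := @rat_in_itvoo R (f t i ord0 - k.+1%:R^-1)
      (f t i ord0 + k.+1%:R^-1).
    by rewrite ltrD2l gtrN.
  rewrite in_itv/= => qi; exists q; by rewrite /ball/= ltr_distl.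
exists ([ffun i => q i], k) => //.
have cft : cube ([ffun i => q i], k) (f t) by move=> i; rewrite /= ffunE.
suff -> : good ([ffun i => q i], k) by [].
apply/asboolP => v vc; apply: eU.
split=> // i j; rewrite (ord1 j) [e]splitr.
apply: (@ball_triangle R _ (ratr (q i) : R)).
  by apply/ball_sym/(le_ball (ltW ke))/qP.
by apply: (le_ball (ltW ke)); have := vc i; rewrite /= ffunE.
Qed.

End measurable_coordinates.

Section lebesgue_measure_cV_def.
Context (R : realType).

Definition vcons n (z : R * 'cV[R]_n) : 'cV[R]_n.+1 :=
  \col_i oapp (fun j => z.2 j ord0) z.1 (unlift ord0 i).

Lemma measurable_vcons n : measurable_fun setT (@vcons n).
Proof.
apply: measurable_fun_cV => i; rewrite /vcons.
under eq_fun do rewrite mxE.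
case: unliftP => [j _|_] /=; last exact: measurable_fst.
apply: (@measurableT_comp _ _ _ _ _ _ (fun v : 'cV[R]_n => v j ord0)) => //.
exact: measurable_coord.
Qed.

Definition vuncons n (v : 'cV[R]_n.+1) : R * 'cV[R]_n :=
  (v ord0 ord0, \col_j v (lift ord0 j) ord0).

Lemma measurable_vuncons n : measurable_fun setT (@vuncons n).
Proof.
apply: measurable_fun_pair; first exact: measurable_coord.
apply: measurable_fun_cV => i; under eq_fun do rewrite mxE.
exact: measurable_coord.
Qed.

Lemma vconsK n : cancel (@vcons n) (@vuncons n).
Proof.
move=> [x v]; rewrite /vuncons /vcons mxE unlift_none/=; congr pair.
by apply/colP => j; rewrite !mxE liftK.
Qed.

Section step.
Context (n : nat) (mu : {sigma_finite_measure set 'cV[R]_n -> \bar R}).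

Definition lebesgue_step : set 'cV[R]_n.+1 -> \bar R :=
  pushforward (@lebesgue_measure R \x mu)%E (@vcons n).

Let step_measure : {measure set 'cV[R]_n.+1 -> \bar R} :=
  measure_function_pushforward__canonical__measure_function_Measure
    (@lebesgue_measure R \x mu)%E (@measurable_vcons n).

HB.instance Definition _ := Measure.copy lebesgue_step step_measure.

Let lebesgue_step_sigma_finite : sigma_finite setT lebesgue_step.
Proof.
have /sigma_finiteP[F [FT ndF Foo]] := sigma_finiteT (@lebesgue_measure R).
have /sigma_finiteP[G [GT ndG Goo]] := sigma_finiteT mu.
exists (fun k => @vuncons n @^-1` (F k `*` G k)) => [|k].
  rewrite -preimage_bigcup (_ : \bigcup_k _ = setT) ?preimage_setT//.
  apply/seteqP; split=> // -[x v] _.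
  have [i _ Fix] : (\bigcup_k F k) x by rewrite -FT.
  have [j _ Gjv] : (\bigcup_k G k) v by rewrite -GT.
  exists (maxn i j) => //; split=> /=.
  - by move: x Fix; exact/subsetPset/ndF/leq_maxl.
  - by move: v Gjv; exact/subsetPset/ndG/leq_maxr.
have [mF Fk] := Foo k; have [mG Gk] := Goo k; split.
  by rewrite -[X in measurable X]setTI; apply: measurable_vuncons => //;
    exact: measurableX.
rewrite /lebesgue_step /pushforward -comp_preimage.
rewrite (_ : _ \o _ = id); last by apply/funext => z; exact: vconsK.
rewrite preimage_id product_measure1E// lte_mul_pinfty//.
by rewrite ge0_fin_numE.
Qed.

HB.instance Definition _ :=
  Measure_isSigmaFinite.Build _ _ _ lebesgue_step lebesgue_step_sigma_finite.

End step.

(* The n-fold product of the one-dimensional Lebesgue measure, transported to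
   'cV[R]_n along R * 'cV[R]_n ~ 'cV[R]_n.+1 at each step. *)
Fixpoint lebesgue_measure_cV n :
    {sigma_finite_measure set 'cV[R]_n -> \bar R} :=
  if n is n'.+1 then lebesgue_step (lebesgue_measure_cV n')
  else \d_ (0 : 'cV[R]_0).

Lemma lebesgue_measure_cV_box n (A : 'I_n -> set R) :
  (forall i, measurable (A i)) ->
  lebesgue_measure_cV n [set v | forall i, A i (v i ord0)] =
    (\prod_(i < n) @lebesgue_measure R (A i))%E.
Proof.
elim: n A => [|n IHn] A mA /=.
  by rewrite big_ord0 diracE mem_set// => -[].
have mbox : measurable [set v : 'cV[R]_n |
    forall i : 'I_n, A (lift ord0 i) (v i ord0)].
  rewrite [X in measurable X](_ : _ = \bigcap_(i in [set: 'I_n])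
      ((fun v : 'cV[R]_n => v i ord0) @^-1` A (lift ord0 i))).
    apply: fin_bigcap_measurable; first exact: finite_finset.
    by move=> i _; rewrite -[X in measurable X]setTI;
      exact: (@measurable_coord _ _ _ i ord0 measurableT).
  by apply/seteqP; split=> v /= h i; [move=> _|]; exact: h.
rewrite big_ord_recl -IHn// -product_measure1E//; last exact: mA.
rewrite /lebesgue_step /pushforward; congr (product_measure1 _ _ _).
apply/seteqP; split=> -[x v] /= h.
  split=> [|i]; first by have := h ord0; rewrite mxE unlift_none.
  by have := h (lift ord0 i); rewrite mxE liftK.
case: h => hx hv i; rewrite mxE.
by case: unliftP => [j ->|->]; [exact: hv|exact: hx].
Qed.

End lebesgue_measure_cV_def.

Section random_vectors.
Context d (Omega : measurableType d) (R : realType) (P : probability Omega R).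

Definition mutually_independent d' (T : measurableType d') (I : finType)
    (X : I -> {RV P >-> T}) : Prop :=
  forall (J : {set I}) (B : I -> set T), (forall i, measurable (B i)) ->
    P (\bigcap_(i in [set` J]) (X i @^-1` B i)) =
      (\prod_(i in J) P (X i @^-1` B i))%E.

Definition identically_distributed d' (T : measurableType d') (I : Type)
    (X : I -> {RV P >-> T}) : Prop :=
  forall i j (B : set T), measurable B ->
    distribution P (X i) B = distribution P (X j) B.

Definition has_density n (X : {RV P >-> 'cV[R]_n}) : Prop :=
  exists f : 'cV[R]_n -> R,
    [/\ measurable_fun setT f, forall v, 0 <= f v &
        forall B, measurable B -> distribution P X B =
          (\int[lebesgue_measure_cV R n]_(v in B) (f v)%:E)%E].

End random_vectors.

(* x is defined on all of nat, but constrained only at the times 0, ..., N. *)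
Definition dpv_trajectory (R : realType) (Omega : Type) (N n m p l : nat)
    (Par : {fset 'cV[R]_l}) (A : Par -> 'M[R]_n) (B : Par -> 'M[R]_(n, m))
    (F : Par -> 'M[R]_(n, p)) (lam : 'I_N -> Par) (u : 'I_N -> 'cV[R]_m)
    (x0 : 'cV[R]_n) (w : 'I_N -> Omega -> 'cV[R]_p)
    (x : nat -> Omega -> 'cV[R]_n) : Prop :=
  (forall o, x 0%N o = x0) /\
  (forall (t : 'I_N) o,
     x t.+1 o = A (lam t) *m x t o + B (lam t) *m u t + F (lam t) *m w t o).

Section occupancy.
Context (R : realType) (n : nat) (h_obs : 'cV[R]_n -> R).

Definition obstacle (c : 'cV[R]_n) : set 'cV[R]_n :=
  [set z | 0 <= h_obs (z - c)].

Context d (Omega : measurableType d) (P : probability Omega R)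
  (x : nat -> Omega -> 'cV[R]_n).

Definition occupancy (y : 'cV[R]_n) (tau : nat) : \bar R :=
  P (x tau @^-1` [set z | obstacle z y]).

Definition pr_occupy_set (alpha : R) (tau : nat) : set 'cV[R]_n :=
  [set y | (alpha%:E <= occupancy y tau)%E].

End occupancy.

(* Main.v *)
(* Each state is Borel, so the state at time tau has a tight law: its norm exceeds
   some k with probability less than alpha. If the shape lies in the ball of
   radius M and the norm of y exceeds k + M, then y belongs to the obstacle
   centred at the state only on that event. *)
Require Import Defs.
From mathcomp Require Import all_boot all_order all_algebra finmap.
From mathcomp Require Import all_classical all_reals all_analysis.
From mathcomp Require Import measurable_realfun.
Import Order.TTheory GRing.Theory Num.Theory numFieldNormedType.Exports.
Local Open Scope classical_set_scope.
Local Open Scope ring_scope.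

(** Each coordinate is a finite linear combination of the measurable coordinates of [f]. *)
Lemma measurable_fun_mulmx {R : realType} {d} {T : measurableType d} {m n : nat}
    (M : 'M[R]_(m, n)) (f : T -> 'cV[R]_n) :
  measurable_fun setT f -> measurable_fun setT (fun t => M *m f t).
Proof.
move=> mf; apply: measurable_fun_cV => i.
under eq_fun do rewrite mxE.
apply: measurable_sum => j; apply: measurable_funM => //.
exact: measurableT_comp (@measurable_coord R _ _ j ord0) mf.
Qed.

Lemma measurable_fun_cVD {R : realType} {d} {T : measurableType d} {n : nat}
    (f g : T -> 'cV[R]_n) :
  measurable_fun setT f -> measurable_fun setT g ->
  measurable_fun setT (fun t => f t + g t).
Proof.
move=> mf mg; apply: measurable_fun_cV => i.
under eq_fun do rewrite mxE.
by apply: measurable_funD;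
  exact: measurableT_comp (@measurable_coord R _ _ i ord0) _.
Qed.

(** Induction on [t]: the next state is a sum of linear images of measurable vectors and a constant
    one. The recursion holds only at times below [N], hence the bound on [t]. *)
Lemma measurable_dpv_trajectory {R : realType} {d} {Omega : measurableType d}
    {N n m p l : nat} {Par : {fset 'cV[R]_l}} {A : Par -> 'M[R]_n}
    {B : Par -> 'M[R]_(n, m)} {F : Par -> 'M[R]_(n, p)} {lam : 'I_N -> Par}
    {u : 'I_N -> 'cV[R]_m} {x0 : 'cV[R]_n} {w : 'I_N -> Omega -> 'cV[R]_p}
    {x : nat -> Omega -> 'cV[R]_n} :
  (forall t, measurable_fun setT (w t)) ->
  dpv_trajectory A B F lam u x0 w x ->
  forall t, (t <= N)%N -> measurable_fun setT (x t).
Proof.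
move=> mw [x_init x_step]; elim=> [_|t IHt tN].
  by rewrite (_ : x 0%N = cst x0)//; apply/funext => o; exact: x_init.
rewrite (_ : x t.+1 = fun o => A (lam (Ordinal tN)) *m x t o +
    B (lam (Ordinal tN)) *m u (Ordinal tN) +
    F (lam (Ordinal tN)) *m w (Ordinal tN) o); last first.
  by apply/funext => o; exact: (x_step (Ordinal tN)).
apply: measurable_fun_cVD; last exact: measurable_fun_mulmx.
apply: measurable_fun_cVD; last exact: measurable_cst.
exact/measurable_fun_mulmx/IHt/ltnW.
Qed.

Lemma measurable_norm_gt {R : realType} {d} {T : measurableType d} {n : nat}
    (f : T -> 'cV[R]_n) (r : R) :
  measurable_fun setT f -> measurable (f @^-1` [set z | r < `|z|]).
Proof.
move=> mf; rewrite -[X in measurable X]setTI; apply: mf => //.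
apply: sub_sigma_algebra.
rewrite (_ : [set z | _] = Num.norm @^-1` [set s | r < s])//.
by apply: open_comp; [move=> z _; exact: norm_continuous|exact: open_gt].
Qed.

(** Continuity from above: the tail events decrease to the empty set, so their probabilities tend to
    0. *)
Lemma probability_norm_tight {R : realType} {d} {Omega : measurableType d}
    (P : probability Omega R) {n : nat} (X : Omega -> 'cV[R]_n) (alpha : R) :
  measurable_fun setT X -> 0 < alpha ->
  exists k : nat, (P (X @^-1` [set z | (k%:R < `|z|)%R]) < alpha%:E)%E.
Proof.
move=> mX alpha0.
pose S k := X @^-1` [set z | k%:R < `|z|].
have mS k : measurable (S k) by exact: measurable_norm_gt.
have S0 : \bigcap_k S k = set0.
  (* By the Archimedean property, every outcome leaves the tail event whose index exceeds its
     norm. *)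
  apply/seteqP; split=> // o /(_ (Num.bound `|X o|) I); rewrite /S /=.
  by rewrite ltNge ltW// archi_boundP.
have : P \o S @ \oo --> P (\bigcap_k S k).
  apply: nonincreasing_cvg_mu => //.
  - by rewrite (le_lt_trans (probability_le1 P (mS 0%N)))// ltry.
  - by rewrite S0.
  - move=> i j ij; apply/subsetPset => o /=; apply: le_lt_trans.
    by rewrite ler_nat.
(* The open ray below [alpha] is a neighbourhood of the limit 0; the rank from which the sequence
   stays in it is the witness. *)
rewrite S0 measure0 => /(_ [set y | (y < alpha%:E)%E])[|k _ /(_ k (leqnn k))].
  by apply: open_nbhs_nbhs; split; [exact: open_ereal_lt_ereal|rewrite /= lte_fin].
by exists k.
Qed.

(* [ex_bound] would require [S] to be nonempty. *)
Lemma bounded_setP {R : realType} {V : normedModType R} (S : set V) :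
  bounded_set S <-> exists M : R, forall z, S z -> `|z| <= M.
Proof.
split=> [[M [_ SM]]|[M SM]].
  (* [bounded_set] gives the estimate only for constants strictly above [M]. *)
  by exists (M + 1) => z; apply: SM; rewrite ltrDl.
exists M; split; first exact: num_real.
by move=> r Mr z Sz; rewrite /= (le_trans (SM _ Sz))// ltW.
Qed.

(** Obstacles are translates of the shape, so its boundedness and measurability carry over to every
    centre. *)
Lemma obstacleE {R : realType} {n : nat} (h : 'cV[R]_n -> R) (c z : 'cV[R]_n) :
  obstacle h c z = obstacle h 0 (z - c).
Proof. by rewrite /obstacle /= subr0. Qed.

Theorem proposition5 (R : realType) (N n m p l : nat)
    (hN : (0 < N)%N) (hn : (0 < n)%N) (hm : (0 < m)%N) (hp : (0 < p)%N)
    (hl : (0 < l)%N)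
    (d : measure_display) (Omega : measurableType d) (P : probability Omega R)
    (Par : {fset 'cV[R]_l}) (A : Par -> 'M[R]_n) (B : Par -> 'M[R]_(n, m))
    (F : Par -> 'M[R]_(n, p)) (lam : 'I_N -> Par) (u : 'I_N -> 'cV[R]_m)
    (x0 : 'cV[R]_n) (w : 'I_N -> {RV P >-> 'cV[R]_p})
    (w_indep : mutually_independent w)
    (w_ident : identically_distributed w)
    (w_density : forall t, has_density (w t))
    (x : nat -> Omega -> 'cV[R]_n)
    (x_traj : dpv_trajectory A B F lam u x0 w x)
    (h_obs : 'cV[R]_n -> R) (h_obs_borel : measurable_fun setT h_obs)
    (shape_borel : measurable (obstacle h_obs 0))
    (shape_neq0 : lebesgue_measure_cV R n (obstacle h_obs 0) != 0%E) :
  bounded_set (obstacle h_obs 0) ->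
  forall (alpha : R) (tau : nat), 0 < alpha -> (1 <= tau <= N)%N ->
    bounded_set (pr_occupy_set h_obs P x alpha tau).
Proof.
move=> /bounded_setP[M shape_le] alpha tau alpha0 /andP[_ tauN].
have mx : measurable_fun setT (x tau).
  by apply: measurable_dpv_trajectory x_traj _ tauN => t; exact: measurable_funPT.
have [k Pk] := @probability_norm_tight _ _ _ P _ _ _ mx alpha0.
apply/bounded_setP; exists (k%:R + M) => y /= alpha_le.
rewrite leNgt; apply/negP => y_gt.
suff : (occupancy h_obs P x y tau <=
    P (x tau @^-1` [set z | (k%:R < `|z|)%R]))%E.
  by move=> /(le_trans alpha_le)/le_lt_trans/(_ Pk); rewrite ltxx.
apply: le_measure.
(* The occupancy event is the preimage of the Borel shape under [y] minus the state; the minus sign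
   becomes a matrix so that [measurable_fun_mulmx] applies. *)
- rewrite inE; rewrite (_ : _ @^-1` _ =
      (fun o => y + - 1%:M *m x tau o) @^-1` obstacle h_obs 0); last first.
    by apply/funext => o /=; rewrite obstacleE mulNmx mul1mx.
  rewrite -[X in measurable X]setTI.
  apply: measurable_fun_cVD shape_borel => //; exact: measurable_fun_mulmx.
- by rewrite inE; exact: measurable_norm_gt.
- move=> o /=; rewrite obstacleE => /shape_le /= yx.
  (* Triangle inequality for [y] as the sum of [y - x tau o], of norm at most [M], and [x tau o]. *)
  rewrite -(ltrD2r M) (lt_le_trans y_gt)//.
  rewrite -[y in leLHS](subrK (x tau o)).
  by rewrite (le_trans (ler_normD _ _))// addrC lerD2l.
Qed.
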